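(* Let $\mathcal{E}=(\mathcal{U},\tilde\varphi,\mathcal{J})$ be an exchangeability system for a noncommutative probability space $(\mathcal{A},\varphi)$ and let $X_1,\dots,X_n\in\mathcal{A}$. Let $\pi\in\Pi_n$ and $\rho\in NC_n$ be such that $\rho\ge\pi$, containing $p=|\pi|$ and $r=|\rho|$ blocks, respectively. Then for $N\ge p$ $$\bigl\|\psi_N(X_1^{(\pi(1))}X_2^{(\pi(2))}\cdots X_n^{(\pi(n))})-\psi_N[\rho](X_1^{(\pi(1))},X_2^{(\pi(2))},\dots,X_n^{(\pi(n))})\bigr\|\le\frac{(2r-1)p^2}{N-p+1}\prod_{i=1}^n\|X_i\|.$$
   Context: All algebras are unital complex $C^*$- or pre-$C^*$-algebras, and $\|\cdot\|$ is the $C^*$-norm. A noncommutative probability space is a pair $(\mathcal{A},\varphi)$ of such an algebra and a state $\varphi$ on it. Exchangeability system. An exchangeability system $\mathcal{E}=(\mathcal{U},\tilde\varphi,\mathcal{J})$ for $(\mathcal{A},\varphi)$ consists of a noncommutative probability space $(\mathcal{U},\tilde\varphi)$ and an infinite family $\mathcal{J}=(\iota_k)_{k\in\mathbf{N}}$ of state-preserving embeddings ($*$-homomorphisms with $\tilde\varphi\circ\iota_k=\varphi$) $\iota_k:\mathcal{A}\to\mathcal{A}_k\subseteq\mathcal{U}$, written $X\mapsto X^{(k)}$, such that for all $n$, $X_1,\dots,X_n\in\mathcal{A}$, $h:[n]\to\mathbf{N}$ (where $[n]=\{1,\dots,n\}$) and $\sigma\in\mathfrak{S}_\infty$ (permutations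 of $\mathbf{N}$) $$\tilde\varphi(X_1^{(h(1))}\cdots X_n^{(h(n))})=\tilde\varphi(X_1^{(\sigma(h(1)))}\cdots X_n^{(\sigma(h(n)))}).$$ It is assumed that $\mathcal{U}$ is generated by the algebras $\mathcal{A}_k$ and that the action $\sigma(X^{(k)})=X^{(\sigma(k))}$ of $\mathfrak{S}_\infty$ extends to all of $\mathcal{U}$ leaving $\tilde\varphi$ invariant. Partitions. $\Pi_n$ is the lattice of set partitions of $[n]$, $\pi\le\rho$ meaning $\pi$ is finer than $\rho$; $NC_n\subseteq\Pi_n$ is the set of noncrossing partitions (no $i<j<k<l$ with $i\sim k$, $j\sim l$, $i\not\sim j$). The blocks of $\pi\in\Pi_n$ are numbered $1,\dots,|\pi|$ and $\pi(i)$ denotes the number of the block containing $i$. Symmetrizing maps. $\psi_N:\mathcal{U}\to\mathcal{U}$ is $\psi_N(X)=\frac{1}{N!}\sum_{\sigma\in\mathfrak{S}_N}\sigma(X)$; it is a conditional expectation onto the $\mathfrak{S}_N$-invariant elements of $\mathcal{U}$. For $\rho\in NC_n$ the map $\psi_N[\rho]$ is defined recursively for $Y_1,\dots,Y_n\in\mathcal{U}$: $\psi_N[\hat 1_n](Y_1,\dots,Y_n)=\psi_N(Y_1\cdots Y_n)$ for the one-block partition $\hat1_n$; otherwise choose an interval block $b=\{k,k+1,\dots,l\}$ of $\rho$ and put $$\psi_N[\rho](Y_1,\dots,Y_n)=\psi_N[\rho\setminus b](Y_1,\dots,Y_{k-1},\psi_N(Y_kY_{k+1}\cdots Y_l)Y_{l+1},\dots,Y_n)$$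 (if $l=n$, the factor $\psi_N(Y_k\cdots Y_n)$ is instead multiplied from the right to $Y_{k-1}$).
   Formalization: The embeddings and the action of the permutations are assumed to be bounded *-homomorphisms; this is automatic for C*-algebras, but for pre-C*-algebras the inequality can fail with unbounded embeddings. *)

(* Defs.v *)
From HB Require Import structures.
From mathcomp Require Import all_boot all_order all_algebra all_fingroup.
From mathcomp Require Import reals complex.

Set Implicit Arguments.
Unset Strict Implicit.
Unset Printing Implicit Defensive.

Import Order.TTheory GRing.Theory Num.Theory ComplexField.

Local Open Scope complex_scope.
Local Open Scope ring_scope.

(* Unital complex pre-C*-algebras; no completeness is required, so the
   C*-algebras are the complete objects of this class.  The norm is not the
   library's normr: a join of the ring and normed Z-module structures is rejected
   by Hierarchy Builder, as numDomainType does not inherit from that join. *)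
HB.mixin Record isPreCStarAlgebra (R : realType) A & GRing.Algebra R[i] A := {
  star : A -> A;
  cnorm : A -> R;
  starK : involutive star;
  starD : forall x y : A, star (x + y) = star x + star y;
  starZ : forall (a : R[i]) (x : A), star (a *: x) = a^*%C *: star x;
  starM : forall x y : A, star (x * y) = star y * star x;
  cnorm_eq0 : forall x : A, cnorm x = 0 -> x = 0;
  cnormD : forall x y : A, cnorm (x + y) <= cnorm x + cnorm y;
  cnormZ : forall (a : R[i]) (x : A), cnorm (a *: x) = Normc.normc a * cnorm x;
  cnormM : forall x y : A, cnorm (x * y) <= cnorm x * cnorm y;
  cnorm_star : forall x : A, cnorm (star x * x) = cnorm x ^+ 2
}.

#[short(type="preCStarAlgType")]
HB.structure Definition PreCStarAlgebra (R : realType) :=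
  {A of GRing.Algebra R[i] A & isPreCStarAlgebra R A}.

Definition is_state (R : realType) (A : preCStarAlgType R) (phi : A -> R[i]) :=
  phi 1 = 1 /\ forall x : A, 0 <= phi (star x * x).

(* Boundedness is automatic when the domain is a C*-algebra; it has to be
   required for pre-C*-algebras, where a *-homomorphism may be unbounded. *)
Definition star_hom (R : realType) (A B : preCStarAlgType R) (f : A -> B) :=
  (forall x : A, f (star x) = star (f x)) /\
  (exists c : R, forall x : A, cnorm (f x) <= c * cnorm x).

Definition norm_closed (R : realType) (U : preCStarAlgType R) (S : U -> Prop) :=
  forall x : U,
    (forall e : R, 0 < e -> exists2 y, S y & cnorm (x - y) < e) -> S x.

(* Topological generation; in particular it holds when G generates U
   algebraically. *)
Definition generated_by (R : realType) (U : preCStarAlgType R) (G : U -> Prop) :=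
  forall S : U -> Prop,
    norm_closed S -> S 1 ->
    (forall x y, S x -> S y -> S (x + y)) ->
    (forall x y, S x -> S y -> S (x * y)) ->
    (forall (a : R[i]) x, S x -> S (a *: x)) ->
    (forall x, S x -> S (star x)) ->
    (forall x, G x -> S x) -> forall x, S x.

(* The set of indices {1, 2, ...} of the paper is nat = {0, 1, ...} here.  The
   permutations of the index set are the bijective functions; [act s] is
   irrelevant when s is not bijective. *)
Record exchangeability_system (R : realType) (A : preCStarAlgType R)
    (phi : A -> R[i]) := ExchangeabilitySystem {
  ex_alg :> preCStarAlgType R;
  ex_state : {scalar ex_alg};
  embed : nat -> {lrmorphism A -> ex_alg};
  act : (nat -> nat) -> {lrmorphism ex_alg -> ex_alg};
  ex_stateP : is_state ex_state;
  embed_hom : forall k, star_hom (embed k);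
  embed_inj : forall k, injective (embed k);
  embed_state : forall k X, ex_state (embed k X) = phi X;
  exchangeable : forall (n : nat) (X : 'I_n -> A) (h : 'I_n -> nat)
      (s : nat -> nat), bijective s ->
    ex_state (\prod_(i < n) embed (h i) (X i))
    = ex_state (\prod_(i < n) embed (s (h i)) (X i));
  embed_generated :
    generated_by (fun Y : ex_alg => exists k X, Y = embed k X);
  act_hom : forall s, bijective s -> star_hom (act s);
  act_id : forall Y, act id Y = Y;
  act_comp : forall s t, bijective s -> bijective t ->
    forall Y, act (s \o t) Y = act s (act t Y);
  act_embed : forall s, bijective s ->
    forall k X, act s (embed k X) = embed (s k) X;
  act_state : forall s, bijective s ->
    forall Y, ex_state (act s Y) = ex_state Y
}.

(* A permutation of the first N indices, extended by the identity. *)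
Definition perm_nat (N : nat) (s : 'S_N) (k : nat) : nat :=
  if insub k is Some i then val (s i) else k.

Lemma perm_nat_bij (N : nat) (s : 'S_N) : bijective (perm_nat s).
Proof.
have perm_natK (t : 'S_N) : cancel (perm_nat t) (perm_nat t^-1%g).
  move=> k; rewrite /perm_nat; case: (insubP 'I_N k) => [i _ <-|kN].
    by rewrite valK permK.
  by rewrite insubN.
exists (perm_nat s^-1%g); first exact: perm_natK.
by rewrite -{2}[s]invgK; exact: perm_natK.
Qed.

Section Partitions.
Variable n : nat.
Implicit Types (pi rho : {set {set 'I_n}}) (b D : {set 'I_n}).

Definition finer pi rho : Prop :=
  forall B, B \in pi -> exists2 C, C \in rho & B \subset C.

Definition noncrossing rho : Prop :=
  forall B C, B \in rho -> C \in rho ->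
  forall i j k l : 'I_n, (i < j)%N -> (j < k)%N -> (k < l)%N ->
  i \in B -> k \in B -> j \in C -> l \in C -> B = C.

(* When interval blocks are removed one after the other the remaining indices
   keep their names, so rho is a partition of some D = cover rho, and being an
   interval is relative to D. *)
Definition interval_block rho b : Prop :=
  b \in rho /\
  forall i j k : 'I_n, i \in b -> k \in b -> j \in cover rho ->
    (i < j)%N -> (j < k)%N -> j \in b.

Definition after D b : {set 'I_n} := [set j in D | [forall i in b, (i < j)%N]].
Definition before D b : {set 'I_n} := [set j in D | [forall i in b, (j < i)%N]].

Let hull b : {set 'I_n} :=
  [set j : 'I_n | [exists i in b, [exists k in b, (i <= j <= k)%N]]].

Lemma interval_block_ex rho : trivIset rho -> noncrossing rho ->
  rho != set0 -> exists b, interval_block rho b.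
Proof.
move=> tI nc /set0Pn[b0 b0r].
case: (@arg_minnP _ b0 (fun b => b \in rho) (fun b => #|hull b|) b0r) => b br bmin.
exists b; split=> // i j k ib kb /bigcupP[c cr jc] ij jk.
apply: contraT => jNb.
have cb : c != b by apply: contraNneq jNb => <-.
have in_gap y : y \in c -> (i < y < k)%N.
  have disj x : x \in b -> x \notin c.
    move/trivIsetP: tI => /(_ c b cr br cb) /pred0P/(_ x) /=.
    by move=> h xb; move: h; rewrite xb andbT => ->.
  move=> yc; apply/andP; split.
    case: ltngtP => // [yi|/val_inj iy].
      by move: cb; rewrite (nc c b cr br _ _ _ _ yi ij jk yc jc ib kb) eqxx.
    by move: (disj i ib); rewrite iy yc.
  case: (ltngtP y k) => // [ky|/val_inj yk].
    by move: cb; rewrite (nc b c br cr _ _ _ _ ij jk ky ib kb jc yc) eqxx.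
  by move: (disj k kb); rewrite -yk yc.
have : hull c \proper hull b.
  apply/properP; split.
    apply/subsetP => x; rewrite !inE.
    move=> /exists_inP[u uc /exists_inP[v vc /andP[ux xv]]].
    have /andP[iu _] := in_gap u uc; have /andP[_ vk] := in_gap v vc.
    apply/exists_inP; exists i => //; apply/exists_inP; exists k => //.
    by rewrite (leq_trans (ltnW iu) ux) (leq_trans xv (ltnW vk)).
  exists i; rewrite inE.
    apply/exists_inP; exists i => //; apply/exists_inP; exists k => //.
    by rewrite leqnn (ltnW (ltn_trans ij jk)).
  apply/exists_inP => -[u uc /exists_inP[v vc /andP[ui _]]].
  by have /andP[iu _] := in_gap u uc; move: iu; rewrite ltnNge ui.
by move/proper_card; rewrite ltnNge (bmin c cr).
Qed.

End Partitions.

(* Multiply c from the left to the entry of Y following the block b in D; if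
   there is none, from the right to the entry preceding b. *)
Definition absorb (n : nat) (U : nzRingType) (D b : {set 'I_n}) (c : U)
    (Y : 'I_n -> U) (j : 'I_n) : U :=
  if (j \in after D b) && [forall k in after D b, (j <= k)%N] then c * Y j
  else if [&& after D b == set0, j \in before D b
            & [forall k in before D b, (k <= j)%N]] then Y j * c
  else Y j.

Section Symmetrization.
Variables (R : realType) (A : preCStarAlgType R) (phi : A -> R[i]).
Variables (E : exchangeability_system phi) (N : nat).

Definition symmetrize (Y : E) : E :=
  ((N`!)%:R : R[i])^-1 *: \sum_(s : 'S_N) act E (perm_nat s) Y.

(* [symmetrize_nc rho Y Z] : Z is a value of psi_N[rho](Y) for some sequence of
   choices of interval blocks.  Products over sets of indices are taken in
   increasing order of the index. *)
Inductive symmetrize_nc (n : nat) :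
    {set {set 'I_n}} -> ('I_n -> E) -> E -> Prop :=
| SymmetrizeOne (D : {set 'I_n}) (Y : 'I_n -> E) :
    symmetrize_nc [set D] Y (symmetrize (\prod_(i in D) Y i))
| SymmetrizeStep (rho : {set {set 'I_n}}) (b : {set 'I_n})
    (Y : 'I_n -> E) (Z : E) :
    (1 < #|rho|)%N -> interval_block rho b ->
    symmetrize_nc (rho :\ b)
      (absorb (cover rho) b (symmetrize (\prod_(i in b) Y i)) Y) Z ->
    symmetrize_nc rho Y Z.

(* A value exists for every noncrossing partition, so a bound for all values is
   not vacuous. *)
Lemma symmetrize_nc_ex (n : nat) (rho : {set {set 'I_n}}) (Y : 'I_n -> E) :
  trivIset rho -> noncrossing rho -> rho != set0 ->
  exists Z, symmetrize_nc rho Y Z.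
Proof.
have [m] := ubnP #|rho|; elim: m => // m IHm in rho Y *.
rewrite ltnS => cardr tI nc r0; have := r0; rewrite -card_gt0 leq_eqVlt.
case/predU1P => [/esym/eqP/cards1P[D ->]|r_gt1].
  by eexists; exact: SymmetrizeOne.
have [b bint] := interval_block_ex tI nc r0; have [br _] := bint.
have cardb : #|rho| = #|rho :\ b|.+1 by rewrite (cardsD1 b) br.
have [|||| Z HZ] := IHm (rho :\ b)
  (absorb (cover rho) b (symmetrize (\prod_(i in b) Y i)) Y).
- by rewrite -cardb.
- exact: trivIsetS (subsetDl _ _) tI.
- by move=> B C /setD1P[_ Br] /setD1P[_ Cr]; exact: nc.
- by rewrite -card_gt0 -ltnS -cardb.
by exists Z; exact: SymmetrizeStep r_gt1 bint HZ.
Qed.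

End Symmetrization.

(* Main.v *)
Require Import Defs.
From mathcomp Require Import all_boot all_order all_algebra all_fingroup.
From mathcomp Require Import reals complex boolp.
From mathcomp Require Import lra.

Set Implicit Arguments.
Unset Strict Implicit.
Unset Printing Implicit Defensive.

Import Order.TTheory GRing.Theory Num.Theory.

Local Open Scope complex_scope.
Local Open Scope ring_scope.

(** Both sides of the inequality are averages of monomials in which the indices
    of the X_i have been moved by permutations.  On the left a single uniform
    random permutation s moves all of them.  For psi_N[rho] the permutations
    attached to different blocks of rho turn out to be independent: an inner
    factor psi_N(Y_b) is fixed by every permutation of the first N indices, so
    the outer symmetrizations leave it unchanged, and expanding all of them
    gives (symmetrize_ncE)
      psi_N[rho](Y) = mean over (s_B)_(B in rho) of the product of s_(rho(i)) Y_i.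
    Nestedness thus disappears and only the family (s_B) remains.

    For a family (s_B), each block of pi is sent to some index below N by the
    permutation of the block of rho that contains it.  As psi_N[rho](Y) is
    invariant, it equals the mean of psi_N of these monomials.  If
    the images of the p blocks of pi are pairwise distinct, a single permutation
    produces the same images, and the monomial has the same symmetrization as
    the original one (symmetrize_prod_injection): its contribution to the
    difference is 0.  Any other family contributes at most twice the product of
    the norms, since embeddings and permutations are contractive.

    Such families are rare: two blocks of pi inside one block of rho never
    collide, and two blocks of pi in different blocks of rho collide with
    probability 1/N (card_collision), so their proportion is at most
    C(p,2)/N (card_noninjective).  The difference is therefore bounded by
    p(p-1)/N times the product of the norms, and N >= N-p+1, 2r-1 >= 1. *)

(** * Norms and contractivity of bounded star-homomorphisms *)

Section Norm.
Variables (R : realType) (A : preCStarAlgType R).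
Implicit Types x y : A.

Lemma cnorm0 : cnorm (0 : A) = 0.
Proof. by rewrite -(scale0r (0 : A)) cnormZ Normc.normc0 mul0r. Qed.

Lemma cnormN x : cnorm (- x) = cnorm x.
Proof. by rewrite -scaleN1r cnormZ (normcN 1) Normc.normc1 mul1r. Qed.

Lemma cnorm_ge0 x : 0 <= cnorm x.
Proof. by have := cnormD x (- x); rewrite subrr cnorm0 cnormN; lra. Qed.

Lemma star1 : star (1 : A) = 1.
Proof. by rewrite -[LHS]mul1r -{1}(starK 1) -starM mul1r starK. Qed.

Lemma cnorm1 : cnorm (1 : A) <= 1.
Proof.
have := cnorm_star (1 : A); rewrite star1 mulr1 => e.
by have := cnorm_ge0 1; nra.
Qed.

Lemma cnorm_prod (I : Type) (r : seq I) (P : pred I) (F : I -> A) (G : I -> R) :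
  (forall i, cnorm (F i) <= G i) ->
  cnorm (\prod_(i <- r | P i) F i) <= \prod_(i <- r | P i) G i.
Proof.
move=> FG; elim/big_ind2: _ => //; first exact: cnorm1.
by move=> x a y b xa yb; rewrite (le_trans (cnormM _ _))// ler_pM ?cnorm_ge0.
Qed.

Lemma cnorm_sum (I : Type) (r : seq I) (P : pred I) (F : I -> A) :
  cnorm (\sum_(i <- r | P i) F i) <= \sum_(i <- r | P i) cnorm (F i).
Proof.
elim/big_ind2: _ => //; first by rewrite cnorm0.
by move=> x a y b xa yb; rewrite (le_trans (cnormD _ _))// lerD.
Qed.

Lemma starX x k : star (x ^+ k) = star x ^+ k.
Proof. by elim: k => [|k IH]; [exact: star1|rewrite exprS starM IH exprSr]. Qed.

(** Each use of the C*-identity on a self-adjoint power doubles its exponent. *)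
Lemma cnorm_selfadjoint_pow2 x k :
  star x = x -> cnorm (x ^+ (2 ^ k)) = cnorm x ^+ (2 ^ k).
Proof.
move=> sx; elim: k => [|k IH]; first by rewrite !expr1.
by rewrite expnSr !exprM -IH -cnorm_star starX sx expr2.
Qed.

End Norm.

(** If b < a, then (a / b) ^ (2 ^ k) grows without bound in k, by Bernoulli's
    inequality. *)
Lemma le_of_pow2_le (R : realType) (a b c : R) :
  0 <= a -> 0 <= b -> (forall k, a ^+ (2 ^ k) <= c * b ^+ (2 ^ k)) -> a <= b.
Proof.
move=> a0 b0 ab; rewrite leNgt; apply/negP => ba.
have [b_eq0|b_gt0] := eqVneq b 0.
  by have := ab 0%N; rewrite !expr1 b_eq0 mulr0; move: ba; rewrite b_eq0; lra.
have {b0 b_gt0}b_gt0 : 0 < b by rewrite lt_def b_gt0.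
pose d := a / b - 1.
have d_gt0 : 0 < d by rewrite subr_gt0 ltr_pdivlMr // mul1r.
have bernoulli m : 1 + m%:R * d <= (1 + d) ^+ m.
  elim: m => [|m IH]; first by rewrite expr0 mul0r addr0.
  rewrite exprS -natr1.
  have : 0 <= m%:R * d by rewrite mulr_ge0 // ltW.
  by move: (m%:R : R) IH => q; nra.
pose m := Num.bound (`|c| / d).
have mc : c < m%:R * d.
  rewrite -ltr_pdivrMr //; apply: le_lt_trans (archi_boundP _).
    by rewrite ler_pM2r ?invr_gt0 // ler_norm.
  by rewrite divr_ge0 // ltW.
have := ab m; rewrite -ler_pdivrMr ?exprn_gt0 // -expr_div_n.
have -> : a / b = 1 + d by rewrite /d addrC subrK.
have := bernoulli (2 ^ m)%N.
have : (m%:R : R) <= (2 ^ m)%:R by rewrite ler_nat ltnW // ltn_expl.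
by move: ((2 ^ m)%:R : R) (m%:R : R) mc => q q'; nra.
Qed.

(** Some constant c bounds f, hence |f h| ^ (2 ^ k) <= c |h| ^ (2 ^ k) for the
    self-adjoint h = x* x, and taking roots removes c.  The usual
    comparison of spectra would need completeness. *)
Lemma star_hom_contractive (R : realType) (A B : preCStarAlgType R)
    (f : {lrmorphism A -> B}) : star_hom f -> forall x, cnorm (f x) <= cnorm x.
Proof.
move=> [fstar [c fc]] x.
rewrite -(@ler_pXn2r _ 2) ?nnegrE ?cnorm_ge0 //.
rewrite -!cnorm_star -fstar -rmorphM; set h := star x * x.
have sh : star h = h by rewrite /h starM starK.
apply: (@le_of_pow2_le _ _ _ c); rewrite ?cnorm_ge0 // => k.
rewrite -!cnorm_selfadjoint_pow2 -?fstar ?sh // -rmorphXn; exact: fc.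
Qed.

(** * Means over finite types *)

Section Mean.
Variable K : numFieldType.
Implicit Types V W : lmodType K.

Definition mean {V} {T : finType} (F : T -> V) : V :=
  (#|T|%:R : K)^-1 *: \sum_t F t.

Lemma eq_mean V (T : finType) (F G : T -> V) : F =1 G -> mean F = mean G.
Proof. by move=> FG; rewrite /mean (eq_bigr _ (fun t _ => FG t)). Qed.

Lemma mean_const V (T : finType) (v : V) :
  (0 < #|T|)%N -> mean (fun _ : T => v) = v.
Proof.
move=> T_gt0; rewrite /mean sumr_const -scaler_nat scalerA mulVf ?scale1r //.
by rewrite pnatr_eq0 -lt0n.
Qed.

Lemma meanB V (T : finType) (F G : T -> V) :
  mean (fun t => F t - G t) = mean F - mean G.
Proof. by rewrite /mean sumrB scalerBr. Qed.

Lemma linear_mean V W (f : {linear V -> W}) (T : finType) (F : T -> V) :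
  f (mean F) = mean (fun t => f (F t)).
Proof. by rewrite /mean linearZ linear_sum. Qed.

Lemma mean_mull (U : algType K) (T : finType) (F : T -> U) (c : U) :
  mean F * c = mean (fun t => F t * c).
Proof. by rewrite /mean -scalerAl mulr_suml. Qed.

Lemma mean_mulr (U : algType K) (T : finType) (F : T -> U) (c : U) :
  c * mean F = mean (fun t => c * F t).
Proof. by rewrite /mean -scalerAr mulr_sumr. Qed.

Lemma exchange_mean V (S T : finType) (F : S -> T -> V) :
  mean (fun s => mean (F s)) = mean (fun t => mean (F^~ t)).
Proof.
rewrite /mean -!scaler_sumr !scalerA mulrC; congr (_ *: _).
exact: exchange_big.
Qed.

Lemma reindex_mean V (S T : finType) (h : S -> T) (F : T -> V) :
  bijective h -> mean F = mean (F \o h).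
Proof.
move=> hbij; rewrite /mean (bij_eq_card hbij); congr (_ *: _).
exact: reindex (onW_bij _ hbij).
Qed.

Lemma mean_pair V (S T : finType) (F : S -> T -> V) :
  mean (fun s => mean (F s)) = mean (fun u : S * T => F u.1 u.2).
Proof.
rewrite /mean -scaler_sumr scalerA card_prod natrM invfM; congr (_ *: _).
by rewrite pair_big.
Qed.

Definition update {I : finType} {G : Type} (f : {ffun I -> G}) (b : I) (g : G) :=
  [ffun i => if i == b then g else f i].

(** Redrawing one coordinate of a uniform random function leaves it uniform. *)
Lemma mean_update V (I G : finType) (b : I) (F : {ffun I -> G} -> V) :
  (0 < #|G|)%N ->
  mean (fun f => mean (fun g => F (update f b g))) = mean F.
Proof.
move=> G_gt0; rewrite mean_pair.
(* Exchanging the coordinate at b with the redrawn value is an involution. *)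
pose swap (u : {ffun I -> G} * G) := (update u.1 b u.2, u.1 b).
have swapK : involutive swap.
  move=> [f g]; rewrite /swap /= ffunE eqxx; congr pair.
  by apply/ffunP => i; rewrite !ffunE; case: eqVneq => [->|].
have swap_bij : bijective swap by exists swap.
transitivity (mean ((fun u : {ffun I -> G} * G => F u.1) \o swap)) => //.
rewrite -(reindex_mean _ swap_bij) -(mean_pair (fun f _ => F f)).
by apply: eq_mean => f; exact: mean_const.
Qed.

End Mean.
Arguments mean {K V T} F.

Lemma cnorm_mean (R : realType) (A : preCStarAlgType R) (T : finType)
    (F : T -> A) :
  cnorm (mean F) <= #|T|%:R^-1 * \sum_t cnorm (F t).
Proof.
rewrite /mean cnormZ Normc.normcV (normcMn 1) Normc.normc1.
by rewrite ler_wpM2l ?invr_ge0 // cnorm_sum.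
Qed.

(** * Ordered products and removal of an interval *)

Section OrderedProducts.
Variables (n : nat) (U : nzRingType).
Implicit Types (S T : {set 'I_n}) (F V W : 'I_n -> U).

Lemma sorted_enum S : sorted (fun i j : 'I_n => (i < j)%N) (enum S).
Proof.
rewrite /enum_mem -enumT; apply: sorted_filter => [i j k|]; first exact: ltn_trans.
by rewrite -(@sorted_map _ _ val ltn) val_enum_ord iota_ltn_sorted.
Qed.

(** Both sides are strictly increasing sequences with the same entries. *)
Lemma enum_setU_lt S T : (forall i j, i \in S -> j \in T -> (i < j)%N) ->
  enum (S :|: T) = enum S ++ enum T.
Proof.
move=> ST; apply: (@irr_sorted_eq _ (fun i j : 'I_n => (i < j)%N)).
- by move=> i j k; exact: ltn_trans.
- by move=> i; exact: ltnn.
- exact: sorted_enum.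
- rewrite -(@sorted_map _ _ val ltn) sorted_pairwise ?map_cat; last exact: ltn_trans.
  rewrite pairwise_cat -!sorted_pairwise; try exact: ltn_trans.
  rewrite !(@sorted_map _ _ val ltn) !sorted_enum !andbT.
  apply/allrelP => _ _ /mapP[i iS ->] /mapP[j jT ->].
  by rewrite !mem_enum in iS jT; exact: ST.
- by move=> i; rewrite mem_cat !mem_enum inE.
Qed.

Lemma prod_setU_lt S T F : (forall i j, i \in S -> j \in T -> (i < j)%N) ->
  \prod_(i in S :|: T) F i = (\prod_(i in S) F i) * \prod_(i in T) F i.
Proof.
move=> ST; have enumE X : \prod_(i in X) F i = \prod_(i <- enum X) F i.
  by rewrite -big_filter [index_enum _]unlock.
by rewrite !enumE enum_setU_lt // big_cat.
Qed.

Section RemoveInterval.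
Variables (D b : {set 'I_n}).
Hypotheses (bD : b \subset D) (b_neq0 : b != set0).
Hypothesis bint : forall i j k, i \in b -> k \in b -> j \in D ->
  (i < j)%N -> (j < k)%N -> j \in b.

Let loP j : j \in before D b -> j \in D /\ forall i, i \in b -> (j < i)%N.
Proof. by rewrite inE => /andP[jD /forall_inP]. Qed.

Let hiP j : j \in after D b -> j \in D /\ forall i, i \in b -> (i < j)%N.
Proof. by rewrite inE => /andP[jD /forall_inP]. Qed.

Let lo_hi i j : i \in before D b -> j \in after D b -> (i < j)%N.
Proof.
have /set0Pn[k kb] := b_neq0.
by move=> /loP[_ ib] /hiP[_ jb]; exact: ltn_trans (ib _ kb) (jb _ kb).
Qed.

Let not_lo j : j \in b -> j \notin before D b.
Proof. by move=> jb; apply/negP => /loP[_ /(_ _ jb)]; rewrite ltnn. Qed.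

Let not_hi j : j \in b -> j \notin after D b.
Proof. by move=> jb; apply/negP => /hiP[_ /(_ _ jb)]; rewrite ltnn. Qed.

Lemma setD_interval : D :\: b = before D b :|: after D b.
Proof.
have /set0Pn[i ib] := b_neq0.
apply/setP => j; rewrite in_setD in_setU.
have [jb|jb] /= := boolP (j \in b).
  by rewrite (negPf (not_lo jb)) (negPf (not_hi jb)).
rewrite !inE; case jD : (j \in D) => //=; apply/esym/orP.
case: (ltngtP j i) => [ji|ij|/val_inj jE]; last by rewrite jE ib in jb.
  left; apply/forall_inP => k kb; rewrite ltnNge leq_eqVlt; apply/negP.
  case/predU1P => [/val_inj kE|kj]; first by rewrite -kE kb in jb.
  by rewrite (bint (i := k) (k := i)) // in jb.
right; apply/forall_inP => k kb; rewrite ltnNge leq_eqVlt; apply/negP.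
case/predU1P => [/val_inj kE|jk]; first by rewrite kE kb in jb.
by rewrite (bint (i := i) (k := k)) // in jb.
Qed.

Lemma prod_interval V W :
  \prod_(i in D) (if i \in b then V i else W i) =
  (\prod_(i in before D b) W i) * (\prod_(i in b) V i)
    * \prod_(i in after D b) W i.
Proof.
have DE : D = (before D b :|: b) :|: after D b.
  rewrite setUAC -setD_interval; apply/setP => j; rewrite !inE.
  by case: (boolP (j \in b)) => [/(subsetP bD)->|_] /=; rewrite ?orbT ?orbF.
rewrite {1}DE !prod_setU_lt; last 2 first.
- by move=> i j /loP[_ ib]; exact: ib.
- move=> i j /setUP[il|ib] jh; first exact: lo_hi.
  by case: (hiP jh) => _; apply.
congr (_ * _ * _); apply: eq_bigr => i; last 1 first.
- by move=> ih; case: ifP => // /not_hi; rewrite ih.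
- by move=> il; case: ifP => // /not_lo; rewrite il.
- by move=> ->.
Qed.

(** The factor c, attached by absorb to a neighbour of b, ends up exactly where
    the entries of b were, between those before and those after b. *)
Lemma prod_absorb (c : U) W : D :\: b != set0 ->
  \prod_(i in D :\: b) absorb D b c W i =
  (\prod_(i in before D b) W i) * c * \prod_(i in after D b) W i.
Proof.
move=> Db0; rewrite setD_interval prod_setU_lt; last exact: lo_hi.
have [hi0|/set0Pn[j1 j1hi]] := eqVneq (after D b) set0; last first.
  have -> : \prod_(i in before D b) absorb D b c W i =
            \prod_(i in before D b) W i.
    apply: eq_bigr => i il; rewrite /absorb.
    have [ih|_] /= := boolP (i \in after D b).
      by have := lo_hi il ih; rewrite ltnn.
    have -> // : (after D b == set0) = false.
    by apply/negbTE/set0Pn; exists j1.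
  rewrite -mulrA; congr (_ * _).
  case: (@arg_minnP _ j1 (fun j => j \in after D b)
    (fun j : 'I_n => nat_of_ord j) j1hi) => a ah amin.
  have hiE : after D b = [set a] :|: after D b :\ a by rewrite setD1K.
  have a_lt i j : i \in [set a] -> j \in after D b :\ a -> (i < j)%N.
    move=> /set1P -> /setD1P[ja /amin].
    by rewrite leq_eqVlt val_eqE eq_sym (negPf ja).
  rewrite hiE !prod_setU_lt // !big_set1 mulrA; congr (_ * _).
    by rewrite /absorb ah /=; case: ifP => // /negP[]; apply/forall_inP.
  apply: eq_bigr => j /setD1P[ja jh]; rewrite /absorb jh /=.
  case: ifP => [/forall_inP/(_ _ ah) jla|_].
    by case/eqP: ja; apply/val_inj/eqP; rewrite eqn_leq jla amin.
  by case: ifP => // /andP[/eqP h0]; rewrite h0 inE in jh.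
rewrite hi0 !big_set0 !mulr1.
have [j1 j1lo] : exists j, j \in before D b.
  by apply/set0Pn; move: Db0; rewrite setD_interval hi0 setU0.
case: (@arg_maxnP _ j1 (fun j => j \in before D b)
  (fun j : 'I_n => nat_of_ord j) j1lo) => a al amax.
have loE : before D b = before D b :\ a :|: [set a] by rewrite setUC setD1K.
have a_gt i j : i \in before D b :\ a -> j \in [set a] -> (i < j)%N.
  move=> /setD1P[ja /amax] + /set1P ->.
  by rewrite /= leq_eqVlt val_eqE (negPf ja).
rewrite loE !prod_setU_lt // !big_set1 -mulrA; congr (_ * _); last first.
  rewrite /absorb hi0 inE eqxx al /=.
  by case: ifP => // /negP[]; apply/forall_inP.
apply: eq_bigr => j /setD1P[ja jl]; rewrite /absorb hi0 inE eqxx jl /=.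
case: ifP => // /forall_inP/(_ _ al) jla.
by case/eqP: ja; apply/val_inj/eqP; rewrite eqn_leq jla andbT; exact: amax.
Qed.

End RemoveInterval.

End OrderedProducts.

(** * Expansion of the partitioned symmetrization *)

Section Expansion.
Variables (R : realType) (A : preCStarAlgType R) (phi : A -> R[i]).
Variables (E : exchangeability_system phi) (N : nat).
Implicit Types Y : E.

Definition perm_act (s : 'S_N) : {lrmorphism E -> E} := Defs.act E (perm_nat s).

Lemma perm_nat_ord (s : 'S_N) (i : 'I_N) : perm_nat s i = s i.
Proof. by rewrite /perm_nat valK. Qed.

Lemma perm_actM (s t : 'S_N) Y : perm_act (s * t)%g Y = perm_act t (perm_act s Y).
Proof.
rewrite /perm_act -act_comp; try exact: perm_nat_bij.
congr (Defs.act E _ Y); apply/funext => k /=.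
case: (insubP 'I_N k) => [i _ <-|kN]; first by rewrite !perm_nat_ord permM.
by rewrite /perm_nat !insubN.
Qed.

Lemma perm_act_contractive s Y : cnorm (perm_act s Y) <= cnorm Y.
Proof. exact/star_hom_contractive/act_hom/perm_nat_bij. Qed.

Lemma symmetrizeE Y : symmetrize N Y = mean (fun s => perm_act s Y).
Proof. by rewrite /symmetrize /mean card_Sn. Qed.

Lemma symmetrize_perm_act s Y : symmetrize N (perm_act s Y) = symmetrize N Y.
Proof.
rewrite !symmetrizeE (reindex_mean (fun t => perm_act t Y) (injF_bij (mulgI s))).
by apply: eq_mean => t; rewrite /= perm_actM.
Qed.

Lemma perm_act_symmetrize s Y : perm_act s (symmetrize N Y) = symmetrize N Y.
Proof.
rewrite !symmetrizeE linear_mean.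
rewrite [RHS](reindex_mean (fun t => perm_act t Y) (injF_bij (mulIg s))).
by apply: eq_mean => t; rewrite /= perm_actM.
Qed.

Lemma cnorm_symmetrize Y : cnorm (symmetrize N Y) <= cnorm Y.
Proof.
rewrite symmetrizeE (le_trans (cnorm_mean _)) //.
rewrite ler_pdivrMl ?ltr0n ?card_Sn ?fact_gt0 //.
rewrite (le_trans (ler_sum _ (fun s _ => perm_act_contractive s Y))) //.
by rewrite sumr_const card_Sn mulr_natl.
Qed.

Lemma symmetrize_nc_invariant n (rho : {set {set 'I_n}}) (Y : 'I_n -> E) Z :
  symmetrize_nc N rho Y Z -> forall s, perm_act s Z = Z.
Proof. by elim=> // D {}Y s; exact: perm_act_symmetrize. Qed.

(** Induction on the removal of blocks: the factor c = psi_N(Y_b) is fixed by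
    all permutations, so the induction hypothesis leaves it intact.  Expanding c
    draws a fresh permutation for b, which by mean_update may be taken as the
    coordinate at b of the family.  Families are indexed by all sets, so that
    the index type does not change when blocks are removed. *)
Lemma symmetrize_ncE n (rho : {set {set 'I_n}}) (Y : 'I_n -> E) Z :
  symmetrize_nc N rho Y Z -> trivIset rho -> set0 \notin rho ->
  Z = mean (fun f : {ffun {set 'I_n} -> 'S_N} =>
        \prod_(i in cover rho) perm_act (f (pblock rho i)) (Y i)).
Proof.
have SN_gt0 : (0 < #|'S_N|)%N by rewrite card_Sn fact_gt0.
elim=> {rho Y Z} [D Y _ _|rho b Y Z r_gt1 [br bint] _ IH tI r0].
  have coverD : cover [set D] = D by rewrite /cover big_set1.
  rewrite symmetrizeE.
  rewrite -(mean_const (T := {ffun {set 'I_n} -> 'S_N}) (mean _)); last first.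
    by apply/card_gt0P; exists [ffun=> 1%g].
  rewrite -[RHS](mean_update D _ SN_gt0); apply: eq_mean => f.
  apply: eq_mean => s; rewrite coverD rmorph_prod; apply: eq_bigr => i iD.
  by rewrite (@def_pblock _ _ D) ?ffunE ?set11 ?trivIset1 ?eqxx.
set c := symmetrize N _ in IH.
have tI' : trivIset (rho :\ b) := trivIsetS (subsetDl _ _) tI.
have disj B i : B \in rho -> i \in b -> i \in B -> B = b.
  by move=> Br ib iB; rewrite -(def_pblock tI Br iB) (def_pblock tI br ib).
have coverE : cover (rho :\ b) = cover rho :\: b.
  apply/setP => i; rewrite in_setD; apply/bigcupP/andP => [[B /setD1P[Bb Br] iB]|].
    split; last by apply/bigcupP; exists B.
    by apply: contra Bb => ib; apply/eqP/(disj B i).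
  by case=> ib /bigcupP[B Br iB]; exists B => //; rewrite !inE Br andbT;
     apply: contraNneq ib => <-.
have bD : b \subset cover rho by apply: bigcup_sup br.
have b0 : b != set0 by apply: contraNneq r0 => <-.
have Db0 : cover rho :\: b != set0.
  have [B /setD1P[Bb Br]] : exists B, B \in rho :\ b.
    by apply/set0Pn; rewrite -card_gt0; move: r_gt1; rewrite (cardsD1 b) br.
  have /set0Pn[i iB] : B != set0 by apply: contraNneq r0 => <-.
  apply/set0Pn; exists i; rewrite -coverE; apply/bigcupP; exists B => //.
  by rewrite !inE Bb.
rewrite {}IH //; last by rewrite !inE negb_and r0 orbT.
rewrite -[RHS](mean_update b _ SN_gt0); apply: eq_mean => f.
pose W i := perm_act (f (pblock (rho :\ b) i)) (Y i).
(* The permutations pass through absorb, since they fix c. *)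
transitivity (\prod_(i in cover rho :\: b) absorb (cover rho) b c W i).
  rewrite coverE; apply: eq_bigr => i _; rewrite /absorb.
  have fc : perm_act (f (pblock (rho :\ b) i)) c = c by exact: perm_act_symmetrize.
  case: ifP => _; last case: ifP => _ //.
    by rewrite rmorphM; congr (_ * _).
  by rewrite rmorphM; congr (_ * _).
rewrite prod_absorb // /c symmetrizeE mean_mulr mean_mull.
apply: eq_mean => s; rewrite rmorph_prod -(prod_interval bD b0 bint).
apply: eq_bigr => i iD; case: ifP => ib.
  by rewrite (def_pblock tI br ib) ffunE eqxx.
have iD' : i \in cover (rho :\ b) by rewrite coverE inE ib.
have pb := pblock_mem iD'.
have pbE : pblock rho i = pblock (rho :\ b) i.
  apply: def_pblock => //; last by rewrite mem_pblock.
  by case/setD1P: pb.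
by rewrite pbE ffunE; case/setD1P: pb => /negPf ->.
Qed.

End Expansion.

(** * Counting collisions *)

Section Collisions.
Variables (I : finType) (N : nat).
Local Notation T := {ffun I -> 'S_N}.
Implicit Types f : T.

(** A collision has probability 1/N: composing f c with the transposition of x
    and z shows that the number of f with f c x = f d y does not change when x
    is replaced by z, and for each f exactly one z satisfies f c z = f d y. *)
Lemma card_collision (c d : I) (x y : 'I_N) : c != d ->
  ((\sum_(f : T) (f c x == f d y)) * N = #|{ffun I -> 'S_N}|)%N.
Proof.
move=> cd.
have sumz (z : 'I_N) :
    (\sum_(f : T) (f c x == f d y) = \sum_(f : T) (f c z == f d y))%N.
  pose h f := update f c (tperm x z * f c)%g.
  have hK : involutive h.
    move=> f; apply/ffunP => i; rewrite !ffunE eqxx mulgA tperm2 mul1g.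
    by case: eqP => [->|].
  rewrite (reindex_inj (can_inj hK)); apply: eq_bigr => f _.
  by rewrite !ffunE eqxx eq_sym (eq_sym d) (negPf cd) permM tpermL eq_sym.
transitivity (\sum_(z < N) \sum_(f : T) (f c z == f d y))%N.
  by rewrite -(eq_bigr _ (fun z _ => sumz z)) sum_nat_const card_ord mulnC.
rewrite exchange_big /= -sum1_card; apply: eq_bigr => f _.
rewrite (bigD1 ((f c)^-1%g (f d y))) //= permKV eqxx big1 ?addn0 // => z zN.
by apply/eqP; rewrite eqb0; apply: contraNneq zN => <-; rewrite permK.
Qed.

(** Union bound over the pairs u < v; pairs with C u = C v never collide because
    a permutation is injective. *)
Lemma card_noninjective p (C : 'I_p -> I) (x : 'I_p -> 'I_N) : injective x ->
  (#|[set f : {ffun I -> 'S_N} | ~~ injectiveb (fun u => f (C u) (x u))]| * N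
   <= 'C(p, 2) * #|{ffun I -> 'S_N}|)%N.
Proof.
move=> x_inj.
pose hit f (u v : 'I_p) := (C u != C v) && (f (C u) (x u) == f (C v) (x v)).
have badP f : ((~~ injectiveb (fun u => f (C u) (x u)) : nat)
    <= \sum_(v < p) \sum_(u < p | (u < v)%N) hit f u v)%N.
  case: injectiveP => //= /injectiveP; rewrite /injectiveb.
  move/dinjectivePn => [u _ [v /andP[vu _] uv]].
  have hit_uv : hit f u v.
    rewrite /hit uv eqxx andbT; apply: contraNneq vu => Cuv.
    by apply/eqP/x_inj/(@perm_inj _ (f (C u))); rewrite uv Cuv.
  have hit_vu : hit f v u by move: hit_uv; rewrite /hit eq_sym (eq_sym (f _ _)).
  case: (ltngtP u v) => [lt|gt|/val_inj e].
  - by rewrite (bigD1 v) //= (bigD1 u) //= hit_uv.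
  - by rewrite (bigD1 u) //= (bigD1 v) //= hit_vu.
  - by rewrite e eqxx in vu.
rewrite -sum1dep_card big_mkcond.
have le1 : (\sum_(f : T) (if ~~ injectiveb (fun u => f (C u) (x u)) then 1 else 0)
    <= \sum_(v < p) \sum_(u < p | (u < v)%N) \sum_(f : T) hit f u v)%N.
  rewrite [leqRHS](_ : _ =
    \sum_(f : T) \sum_(v < p) \sum_(u < p | (u < v)%N) hit f u v)%N.
    by apply: leq_sum => f _; have := badP f; case: injectiveb.
  by rewrite exchange_big; apply: eq_bigr => v _; rewrite exchange_big.
rewrite (leq_trans (leq_mul le1 (leqnn N))) // big_distrl -bin2_sum big_mkord.
rewrite [leqRHS]big_distrl; apply: leq_sum => v _ /=.
rewrite big_distrl /= -[X in (X * _)%N](card_ord v) -sum_nat_const.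
rewrite (big_ord_widen_cond p predT (fun _ => #|{ffun I -> 'S_N}|)) //=;
  last exact: ltnW.
apply: leq_sum => u _; rewrite /hit; case: eqVneq => [_|Cuv] /=.
  by rewrite big1.
by rewrite card_collision.
Qed.

End Collisions.

(** The values are corrected one at a time, composing with the transposition
    that moves the current image of x w to y w; it fixes the images already
    correct. *)
Lemma perm_extends_injection N p (x y : 'I_p -> 'I_N) :
  injective x -> injective y -> exists s : 'S_N, forall u, s (x u) = y u.
Proof.
move=> x_inj y_inj.
suff ext m : exists s : 'S_N, forall u : 'I_p, (u < m)%N -> s (x u) = y u.
  by have [s sE] := ext p; exists s => u; exact: sE.
elim: m => [|m [s sE]]; first by exists 1%g.
have [mp|pm] := ltnP m p; last by exists s => u _; apply: sE; exact: leq_trans pm.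
pose w := Ordinal mp; exists (s * tperm (s (x w)) (y w))%g => u.
rewrite ltnS leq_eqVlt permM => /predU1P[um|um].
  by rewrite (_ : u = w) ?tpermL //; exact: val_inj.
have uw : u != w by rewrite -val_eqE /= ltn_eqF.
rewrite tpermD; first exact: sE.
  by rewrite (inj_eq perm_inj) (inj_eq x_inj) eq_sym.
by rewrite sE // (inj_eq y_inj) eq_sym.
Qed.

(** * Comparison of the two means *)

Section Comparison.
Variables (R : realType) (A : preCStarAlgType R) (phi : A -> R[i]).
Variables (E : exchangeability_system phi) (n p N : nat) (pN : (p <= N)%N).
Variables (X : 'I_n -> A) (k : 'I_n -> 'I_p).

Lemma perm_act_embed (s : 'S_N) (u : 'I_N) (x : A) :
  perm_act E s (embed E u x) = embed E (s u) x.
Proof. by rewrite -perm_nat_ord; exact/act_embed/perm_nat_bij. Qed.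

(** Only the pattern of equalities among the indices matters under psi_N: the
    change of indices by g is the effect of a single permutation. *)
Lemma symmetrize_prod_injection (g : 'I_p -> 'I_N) : injective g ->
  symmetrize N (\prod_(i < n) embed E (g (k i)) (X i)) =
  symmetrize N (\prod_(i < n) embed E (k i) (X i)).
Proof.
move=> g_inj.
have w_inj : injective (widen_ord pN) by move=> u v [/val_inj].
have [s sE] := perm_extends_injection w_inj g_inj.
rewrite -(symmetrize_perm_act s (\prod_(i < n) embed E (k i) (X i))).
congr symmetrize; rewrite rmorph_prod; apply: eq_bigr => i _.
by rewrite -sE; apply/esym; exact: (perm_act_embed s (widen_ord pN (k i))).
Qed.

(** Z is a mean of symmetrized monomials, each equal to the symmetrization on
    the left unless two of the p indices collide.  The partition pi enters only
    through k, the number of the block of i, and through C, which assigns to a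
    number the block of rho containing that block of pi. *)
Lemma cnorm_symmetrize_sub (rho : {set {set 'I_n}}) (C : 'I_p -> {set 'I_n}) Z :
  partition rho [set: 'I_n] -> (forall i, pblock rho i = C (k i)) ->
  symmetrize_nc N rho (fun i => embed E (k i) (X i)) Z ->
  cnorm (symmetrize N (\prod_(i < n) embed E (k i) (X i)) - Z) * N%:R
    <= 'C(p, 2)%:R * (2 * \prod_(i < n) cnorm (X i)).
Proof.
case/and3P => /eqP cov tI r0 kC Znc.
set Y := symmetrize N _.
pose T := {ffun {set 'I_n} -> 'S_N}.
have T_gt0 : (0 < #|T|)%N by apply/card_gt0P; exists [ffun=> 1%g].
pose g (f : T) u := f (C u) (widen_ord pN u).
pose M (f : T) := \prod_(i < n) embed E (g f (k i)) (X i).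
have ZE : Z = mean (fun f : T => symmetrize N (M f)).
  have Zinv : symmetrize N Z = Z.
    rewrite symmetrizeE -[RHS](mean_const (T := 'S_N) _) ?card_Sn ?fact_gt0 //.
    by apply: eq_mean => s; exact: symmetrize_nc_invariant Znc s.
  rewrite -{1}Zinv symmetrizeE (symmetrize_ncE Znc tI r0) cov.
  under eq_mean => s do rewrite linear_mean.
  rewrite exchange_mean; apply: eq_mean => f; rewrite symmetrizeE.
  apply: eq_mean => s; congr (perm_act E s _).
  apply: eq_big => [i|i _]; first by rewrite inE.
  by rewrite kC; exact: (perm_act_embed _ (widen_ord pN (k i))).
set P := \prod_(i < n) cnorm (X i).
have P_ge0 : 0 <= P by apply: prodr_ge0 => i _; exact: cnorm_ge0.
have normM (h : 'I_n -> nat) :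
    cnorm (symmetrize N (\prod_(i < n) embed E (h i) (X i))) <= P.
  apply: le_trans (cnorm_symmetrize _ _) _; apply: cnorm_prod => i.
  exact/star_hom_contractive/embed_hom.
pose bad := [set f : T | ~~ injectiveb (g f)].
have diff f : cnorm (Y - symmetrize N (M f)) <= (f \in bad)%:R * (2 * P).
  rewrite inE; case: injectiveP => [g_inj|_] /=.
    by rewrite /M symmetrize_prod_injection // subrr cnorm0 mul0r.
  rewrite mul1r (le_trans (cnormD _ _)) // cnormN mulr_natl mulr2n.
  by rewrite lerD // normM.
have bad_card : (#|bad| * N <= 'C(p, 2) * #|T|)%N.
  by apply: card_noninjective => u v [/val_inj].
rewrite ZE -(mean_const (T := T) Y T_gt0) -meanB.
apply: le_trans (ler_wpM2r (ler0n _ N) (cnorm_mean _)) _.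
rewrite -mulrA ler_pdivrMl ?ltr0n //.
apply: le_trans (ler_wpM2r (ler0n _ N) (ler_sum _ (fun f _ => diff f))) _.
rewrite -mulr_suml -natr_sum.
have -> : (\sum_(f : T) (f \in bad) = #|bad|)%N.
  by rewrite -sum1_card [RHS]big_mkcond.
rewrite mulrAC -natrM [leRHS]mulrA -natrM [X in _ <= X%:R * _]mulnC.
by rewrite ler_wpM2r ?mulr_ge0 // ler_nat.
Qed.

End Comparison.

Unset Implicit Arguments.

Theorem lemma2p4 (R : realType) (A : preCStarAlgType R) (phi : {scalar A})
    (phi_state : is_state phi) (E : exchangeability_system phi)
    (n : nat) (n_gt0 : (0 < n)%N) (X : 'I_n -> A)
    (pi rho : {set {set 'I_n}})
    (pi_part : partition pi [set: 'I_n]) (rho_part : partition rho [set: 'I_n])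
    (rho_nc : noncrossing rho) (pi_le_rho : finer pi rho)
    (num : {set 'I_n} -> 'I_#|pi|) (num_inj : {in pi &, injective num})
    (N : nat) (pN : (#|pi| <= N)%N) :
  let Y := fun i : 'I_n => embed E (num (pblock pi i)) (X i) in
  forall Z : E, symmetrize_nc N rho Y Z ->
  cnorm (symmetrize N (\prod_(i < n) Y i) - Z)
    <= (2 * #|rho|%:R - 1) * #|pi|%:R ^+ 2 / (N%:R - #|pi|%:R + 1)
       * \prod_(i < n) cnorm (X i).
Proof.
move=> Y Z Znc.
have [/eqP pcov ptI p0] := and3P pi_part; have [/eqP rcov rtI r0] := and3P rho_part.
have in_pblock i : i \in pblock pi i by rewrite mem_pblock pcov inE.
have pblock_pi i : pblock pi i \in pi by rewrite pblock_mem // pcov inE.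
pose k i := num (pblock pi i).
(* The junk value set0 occurs only for numbers that no block of pi carries. *)
pose C u := if [pick i | k i == u] is Some i then pblock rho i else set0.
have kC i : pblock rho i = C (k i).
  rewrite /C; case: pickP => [j /eqP kj|/(_ i)]; last by rewrite eqxx.
  have ij : pblock pi j = pblock pi i by apply: num_inj.
  have [B Br sub] := pi_le_rho _ (pblock_pi i).
  rewrite (def_pblock rtI Br (subsetP sub _ (in_pblock i))).
  by rewrite (def_pblock rtI Br) // (subsetP sub) // -ij.
have := cnorm_symmetrize_sub pN rho_part kC Znc.
rewrite -/Y -[\prod_(i < n) embed E _ _]/(\prod_(i < n) Y i).
set P := \prod_(i < n) cnorm (X i); set e := cnorm _ => le_e.
have P_ge0 : 0 <= P by apply: prodr_ge0 => i _; exact: cnorm_ge0.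
have p_gt0 : (0 < #|pi|)%N.
  by apply/card_gt0P; exists (pblock pi (Ordinal n_gt0)).
have r_gt0 : (0 < #|rho|)%N.
  apply/card_gt0P; exists (pblock rho (Ordinal n_gt0)).
  by rewrite pblock_mem // rcov inE.
have {p_gt0} p1 : 1 <= #|pi|%:R :> R by rewrite ler1n.
have {r_gt0} r1 : 1 <= #|rho|%:R :> R by rewrite ler1n.
have {pN} pN : #|pi|%:R <= N%:R :> R by rewrite ler_nat.
have binE : 'C(#|pi|, 2)%:R * 2 = #|pi|%:R * (#|pi|%:R - 1) :> R.
  have p_gt0 : (0 < #|pi|)%N by rewrite -(ltr0n R); lra.
  by rewrite -natrM -[2%N]/(2`!)%N bin_ffact ffactnS ffactn1 -subn1 natrM natrB.
rewrite mulrA binE in le_e.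
move: (#|pi|%:R : R) (#|rho|%:R : R) (N%:R : R) p1 r1 pN le_e => p r q p1 r1 pq le_e.
rewrite mulrAC ler_pdivlMr; last by lra.
have e_ge0 : 0 <= e by exact: cnorm_ge0.
(* N - p + 1 <= N, then p (p - 1) <= (2 r - 1) p ^ 2. *)
apply: le_trans (_ : e * q <= _); first by nra.
apply: le_trans le_e _; rewrite ler_wpM2r //; nra.
Qed.
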